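(* Consider the $D_4^{(1)}$ system (defined in the context) restricted to parameters with $\alpha_4=\alpha_3=\alpha_0=\alpha_1$, and set $\beta_0:=\alpha_2$, $\beta_1:=\alpha_1$, so that $\beta_0+2\beta_1=\frac12$. This system has the following invariant divisors: if $\beta_0=0$, then $f_0:=z$ is an invariant divisor; if $\beta_1=0$, then $f_1:=xy(x-\eta)(y-1)$ is an invariant divisor.
   Context: A polynomial $f$ in $x,y,z$ is an invariant divisor of a polynomial system if the derivative $df/dt$ along the system equals $f$ times a polynomial in $x,y,z$ (with coefficients in $\mathbb{C}(t)$). The $D_4^{(1)}$ system. Let $\eta\in\mathbb{C}\setminus\{0\}$, let $b(t)\in\mathbb{C}(t)$ be nonzero, and let $\alpha_0,\dots,\alpha_4\in\mathbb{C}$ satisfy $\alpha_0+\alpha_1+2\alpha_2+\alpha_3+\alpha_4=1$. The $D_4^{(1)}$ system for unknown functions $x,y,z$ of $t$ is $$\frac{2\eta}{b(t)}\frac{dx}{dt}=P,\qquad -\frac{2\eta}{b(t)}\frac{dy}{dt}=Q,\qquad \frac{2\eta}{b(t)}\frac{dz}{dt}=R,$$ where $P=-2x(y-1)yz(x-\eta)(2x-2y+1-\eta)-2(2\alpha_0+2\alpha_1+4\alpha_2+\alpha_3+\alpha_4)x^3y-2(\alpha_0+\alpha_1)xy^3+(5\alpha_0+5\alpha_1+6\alpha_2+\alpha_3+\alpha_4)x^2y^2-\{5\alpha_0+5\alpha_1+6\alpha_2+2\alpha_3-3(2\alpha_0+2\alpha_1+4\alpha_2+\alpha_3+\alpha_4)\eta\}x^2y+\{3(\alpha_0+\alpha_1)-(4\alpha_0+6\alpha_1+6\alpha_2+\alpha_3+\alpha_4)\eta\}xy^2+x^4+2(\alpha_0+\alpha_1+2\alpha_2+\alpha_3-\eta)x^3+2\alpha_1\eta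 y^3+\{(\alpha_0+\alpha_1+2\alpha_2+\alpha_3)(\eta^2-3\eta+1)+\alpha_4\eta^2\}x^2+\alpha_1(\eta-3)\eta y^2+\{-(\alpha_0+\alpha_1)+2(2\alpha_0+3\alpha_1+3\alpha_2+\alpha_3)\eta-(2\alpha_0+2\alpha_1+4\alpha_2+\alpha_3+\alpha_4)\eta^2\}xy+(\alpha_0+\alpha_1+2\alpha_2+\alpha_3)(\eta-1)\eta x-\alpha_1(\eta-1)\eta y$, $Q=2x(y-1)yz(x-\eta)(2x-2y+1-\eta)-2(\alpha_3+\alpha_4)x^3y-2(\alpha_0+\alpha_1+4\alpha_2+2\alpha_3+2\alpha_4)xy^3+(\alpha_0+\alpha_1+6\alpha_2+5\alpha_3+5\alpha_4)x^2y^2+\{-(\alpha_0+\alpha_1+6\alpha_2+4\alpha_3+6\alpha_4)+3(\alpha_3+\alpha_4)\eta\}x^2y+\{3(\alpha_0+\alpha_1+4\alpha_2+2\alpha_3+2\alpha_4)-(2\alpha_0+6\alpha_2+5\alpha_3+5\alpha_4)\eta\}xy^2+y^4+2\alpha_4x^3+2\{(\alpha_0+2\alpha_2+\alpha_3+\alpha_4)\eta-1\}y^3-\alpha_4(3\eta-1)x^2+\{1-3(\alpha_0+2\alpha_2+\alpha_3+\alpha_4)\eta+(\alpha_0+2\alpha_2+\alpha_3+\alpha_4)\eta^2\}y^2+\{-(\alpha_0+\alpha_1+4\alpha_2+2\alpha_3+2\alpha_4)+2(\alpha_0+3\alpha_2+2\alpha_3+3\alpha_4)\eta-(\alpha_3+\alpha_4)\eta^2\}xy+\alpha_4(\eta-1)\eta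 x-(\alpha_0+2\alpha_2+\alpha_3+\alpha_4)(\eta-1)\eta y$, $R=(2x-2y+1-\eta)\{2x^2y+2xy^2-x^2-\eta y^2-2(\eta+1)xy+\eta(x+y)\}z^2+z\big[-2(\alpha_3+\alpha_4)x^3+2(\alpha_0+\alpha_1)y^3+2(\alpha_0+\alpha_1+6\alpha_2+2\alpha_3+2\alpha_4)x^2y-2(2\alpha_0+2\alpha_1+6\alpha_2+\alpha_3+\alpha_4)xy^2+\{-(\alpha_0+\alpha_1+6\alpha_2+4\alpha_3)+3(\alpha_3+\alpha_4)\eta\}x^2+\{-3(\alpha_0+\alpha_1)+(4\alpha_0+6\alpha_2+\alpha_3+\alpha_4)\eta\}y^2-4\{-(\alpha_0+\alpha_1+3\alpha_2+\alpha_3)+(\alpha_0+3\alpha_2+\alpha_3+\alpha_4)\eta\}xy+\{-(\alpha_0+\alpha_1+4\alpha_2+2\alpha_3)+2(\alpha_0+3\alpha_2+2\alpha_3)\eta-(\alpha_3+\alpha_4)\eta^2\}x+\{\alpha_0+\alpha_1-2(2\alpha_0+3\alpha_2+\alpha_3)\eta+(2\alpha_0+4\alpha_2+\alpha_3+\alpha_4)\eta^2\}y-(\alpha_0+2\alpha_2+\alpha_3)(\eta-1)\eta\big]+\alpha_2\big[(\alpha_0+\alpha_1+2\alpha_2-\alpha_3-\alpha_4)x^2+(\alpha_0+\alpha_1-2\alpha_2-\alpha_3-\alpha_4)y^2-2(\alpha_0+\alpha_1-\alpha_3-\alpha_4)xy+\{\alpha_0+\alpha_1-2\alpha_3-(2\alpha_0+2\alpha_2-\alpha_3-\alpha_4)\eta\}x+\{-\alpha_0-\alpha_1+2\alpha_2+2\alpha_3+(2\alpha_0-\alpha_3-\alpha_4)\eta\}y+(\eta-1)(\alpha_2+\alpha_3+(\alpha_0+\alpha_2)\eta)\big]$.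 *)

(* Defs.v *)
From mathcomp Require Import all_boot all_order all_algebra.
From mathcomp Require Import generic_quotient fraction.
From mathcomp Require Import mpoly.
From mathcomp Require Import complex.
From mathcomp Require Import reals.
From mathcomp Require Import ring.

Set Implicit Arguments.
Unset Strict Implicit.
Unset Printing Implicit Defensive.

Import GRing.Theory.
Local Open Scope ring_scope.

Notation "x %:F" := (@FracField.tofrac _ x) : ring_scope.

Section RationalFunctions.

Variable K : fieldType.

(* d/dt on K(t), by the quotient rule on a representative fraction; it does
   not depend on the representative, see [frac_deriv_div]. *)
Definition frac_deriv (u : {fraction {poly K}}) : {fraction {poly K}} :=
  let r := repr u in
  let p := \n_r in let q := \d_r in
  (p^`() * q - p * q^`())%:F / (q ^+ 2)%:F.

Lemma frac_repr (u : {fraction {poly K}}) :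
  u = (\n_(repr u))%:F / (\d_(repr u))%:F.
Proof.
have d0 : \d_(repr u) != 0 by rewrite denom_ratioP.
rewrite -{1}[u]reprK; unlock FracField.tofrac.
rewrite -[X in _ = _ * X]FracField.pi_inv -[RHS]FracField.pi_mul.
rewrite /FracField.mulf /FracField.invf /= !numden_Ratio ?oner_neq0 //.
by rewrite mulr1 mul1r Ratio_numden.
Qed.

Lemma frac_deriv_div (p q : {poly K}) : q != 0 ->
  frac_deriv (p%:F / q%:F) = (p^`() * q - p * q^`())%:F / (q ^+ 2)%:F.
Proof.
move=> q0; set u := _ / _; rewrite /frac_deriv.
have r0 : \d_(repr u) != 0 by rewrite denom_ratioP.
set r := \d_(repr u) in r0 *; set n := \n_(repr u).
have /eqP : u = n%:F / r%:F by exact: frac_repr.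
rewrite /u eqr_div ?tofrac_eq0 // -!tofracM tofrac_eq => /eqP e.
apply/eqP; rewrite eqr_div ?tofrac_eq0 ?expf_neq0 // -!tofracM tofrac_eq.
have := congr1 (@deriv K) e; rewrite !derivM => e'.
apply/eqP/subr0_eq; transitivity
    (r * q * ((n^`() * q + n * q^`()) - (p^`() * r + p * r^`()))
     - (n * q - p * r) * (q^`() * r + q * r^`())); first by ring.
by rewrite e' e !subrr mulr0 mul0r subr0.
Qed.

End RationalFunctions.

Section InvariantDivisors.

Variables (K : fieldType) (n : nat).

Let A := {mpoly {fraction {poly K}}[n]}.

(* A polynomial system  dx_i/dt = v i  over K(t): the derivative of f along it,
   where the first summand differentiates the coefficients of f. *)
Definition deriv_along (v : 'I_n -> A) (f : A) : A :=
  map_mpoly (@frac_deriv K) f + \sum_(i < n) f^`M(i) * v i.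

Definition invariant_divisor (v : 'I_n -> A) (f : A) : Prop :=
  exists g : A, deriv_along v f = f * g.

Lemma deriv_alongX (v : 'I_n -> A) (i : 'I_n) : deriv_along v 'X_i = v i.
Proof.
have d1 : frac_deriv (1 : {fraction {poly K}}) = 0.
  by rewrite -[1]divr1 -tofrac1 frac_deriv_div ?oner_neq0 // derivE !mul0r
    mulr0 subrr tofrac0 mul0r.
rewrite /deriv_along /map_mpoly /mmap msuppX big_seq1 /= mcoeffX eqxx d1.
rewrite mpolyC0 mul0r add0r (bigD1 i) //= mderivX mnm1E eqxx scale1r.
have -> : (U_(i) - U_(i))%MM = 0%MM by apply/mnmP => k; rewrite mnmBE mnm0E subnn.
rewrite mpolyX0 mul1r big1 ?addr0 // => j ji.
by rewrite mderivX mnm1E eq_sym (negPf ji) scale0r mul0r.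
Qed.

End InvariantDivisors.

Section D4.

Variable A : comNzRingType.
Variables eta a0 a1 a2 a3 a4 : A.
Variables x y z : A.

Definition D4_P : A :=
  - 2 * x * (y - 1) * y * z * (x - eta) * (2 * x - 2 * y + 1 - eta)
  - 2 * (2 * a0 + 2 * a1 + 4 * a2 + a3 + a4) * x ^+ 3 * y
  - 2 * (a0 + a1) * x * y ^+ 3
  + (5 * a0 + 5 * a1 + 6 * a2 + a3 + a4) * x ^+ 2 * y ^+ 2
  - (5 * a0 + 5 * a1 + 6 * a2 + 2 * a3
     - 3 * (2 * a0 + 2 * a1 + 4 * a2 + a3 + a4) * eta) * x ^+ 2 * y
  + (3 * (a0 + a1) - (4 * a0 + 6 * a1 + 6 * a2 + a3 + a4) * eta) * x * y ^+ 2
  + x ^+ 4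
  + 2 * (a0 + a1 + 2 * a2 + a3 - eta) * x ^+ 3
  + 2 * a1 * eta * y ^+ 3
  + ((a0 + a1 + 2 * a2 + a3) * (eta ^+ 2 - 3 * eta + 1)
     + a4 * eta ^+ 2) * x ^+ 2
  + a1 * (eta - 3) * eta * y ^+ 2
  + (- (a0 + a1) + 2 * (2 * a0 + 3 * a1 + 3 * a2 + a3) * eta
     - (2 * a0 + 2 * a1 + 4 * a2 + a3 + a4) * eta ^+ 2) * x * y
  + (a0 + a1 + 2 * a2 + a3) * (eta - 1) * eta * x
  - a1 * (eta - 1) * eta * y.

Definition D4_Q : A :=
  2 * x * (y - 1) * y * z * (x - eta) * (2 * x - 2 * y + 1 - eta)
  - 2 * (a3 + a4) * x ^+ 3 * y
  - 2 * (a0 + a1 + 4 * a2 + 2 * a3 + 2 * a4) * x * y ^+ 3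
  + (a0 + a1 + 6 * a2 + 5 * a3 + 5 * a4) * x ^+ 2 * y ^+ 2
  + (- (a0 + a1 + 6 * a2 + 4 * a3 + 6 * a4)
     + 3 * (a3 + a4) * eta) * x ^+ 2 * y
  + (3 * (a0 + a1 + 4 * a2 + 2 * a3 + 2 * a4)
     - (2 * a0 + 6 * a2 + 5 * a3 + 5 * a4) * eta) * x * y ^+ 2
  + y ^+ 4
  + 2 * a4 * x ^+ 3
  + 2 * ((a0 + 2 * a2 + a3 + a4) * eta - 1) * y ^+ 3
  - a4 * (3 * eta - 1) * x ^+ 2
  + (1 - 3 * (a0 + 2 * a2 + a3 + a4) * eta
     + (a0 + 2 * a2 + a3 + a4) * eta ^+ 2) * y ^+ 2
  + (- (a0 + a1 + 4 * a2 + 2 * a3 + 2 * a4)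
     + 2 * (a0 + 3 * a2 + 2 * a3 + 3 * a4) * eta
     - (a3 + a4) * eta ^+ 2) * x * y
  + a4 * (eta - 1) * eta * x
  - (a0 + 2 * a2 + a3 + a4) * (eta - 1) * eta * y.

Definition D4_R : A :=
  (2 * x - 2 * y + 1 - eta)
  * (2 * x ^+ 2 * y + 2 * x * y ^+ 2 - x ^+ 2 - eta * y ^+ 2
     - 2 * (eta + 1) * x * y + eta * (x + y)) * z ^+ 2
  + z *
    (- 2 * (a3 + a4) * x ^+ 3
     + 2 * (a0 + a1) * y ^+ 3
     + 2 * (a0 + a1 + 6 * a2 + 2 * a3 + 2 * a4) * x ^+ 2 * y
     - 2 * (2 * a0 + 2 * a1 + 6 * a2 + a3 + a4) * x * y ^+ 2
     + (- (a0 + a1 + 6 * a2 + 4 * a3) + 3 * (a3 + a4) * eta) * x ^+ 2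
     + (- 3 * (a0 + a1) + (4 * a0 + 6 * a2 + a3 + a4) * eta) * y ^+ 2
     - 4 * (- (a0 + a1 + 3 * a2 + a3) + (a0 + 3 * a2 + a3 + a4) * eta) * x * y
     + (- (a0 + a1 + 4 * a2 + 2 * a3) + 2 * (a0 + 3 * a2 + 2 * a3) * eta
        - (a3 + a4) * eta ^+ 2) * x
     + (a0 + a1 - 2 * (2 * a0 + 3 * a2 + a3) * eta
        + (2 * a0 + 4 * a2 + a3 + a4) * eta ^+ 2) * y
     - (a0 + 2 * a2 + a3) * (eta - 1) * eta)
  + a2 *
    ((a0 + a1 + 2 * a2 - a3 - a4) * x ^+ 2
     + (a0 + a1 - 2 * a2 - a3 - a4) * y ^+ 2
     - 2 * (a0 + a1 - a3 - a4) * x * y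
     + (a0 + a1 - 2 * a3 - (2 * a0 + 2 * a2 - a3 - a4) * eta) * x
     + (- a0 - a1 + 2 * a2 + 2 * a3 + (2 * a0 - a3 - a4) * eta) * y
     + (eta - 1) * (a2 + a3 + (a0 + a2) * eta)).

End D4.

Section D4System.

Variable K : fieldType.

Let F := {fraction {poly K}}.
Let A := {mpoly F[3]}.

Definition cst (c : K) : A := ((c%:P)%:F)%:MP.

Definition varx : A := 'X_0.
Definition vary : A := 'X_1.
Definition varz : A := 'X_2.

(* The system  2 eta/b dx/dt = P,  - 2 eta/b dy/dt = Q,  2 eta/b dz/dt = R,
   solved for the derivatives. *)
Definition D4_system (eta : K) (b : F) (a0 a1 a2 a3 a4 : K) (i : 'I_3) : A :=
  let P := D4_P (cst eta) (cst a0) (cst a1) (cst a2) (cst a3) (cst a4)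
             varx vary varz in
  let Q := D4_Q (cst eta) (cst a0) (cst a1) (cst a2) (cst a3) (cst a4)
             varx vary varz in
  let R := D4_R (cst eta) (cst a0) (cst a1) (cst a2) (cst a3) (cst a4)
             varx vary varz in
  (b / (2 * (eta%:P)%:F)) *: [:: P; - Q; R]`_i.

End D4System.

Arguments varx {K}.
Arguments vary {K}.
Arguments varz {K}.

(* Main.v *)
Require Import Defs.
From HB Require Import structures.
From mathcomp Require Import all_boot all_order all_algebra.
From mathcomp Require Import generic_quotient fraction mpoly complex reals.
From mathcomp Require Import ring.
Import GRing.Theory.
Local Open Scope ring_scope.

(** The derivative along a polynomial system over K(t) is a derivation of
    K(t)[x_1, ..., x_n]: this reduces to the quotient rule on K(t), see
    [frac_derivB] and [frac_derivM].  Hence, if f' = f p and g' = g q, then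
    (f g)' = f g (p + q), and a product of invariant divisors is again one
    ([invariant_divisorM]).

    Since z' is a multiple of R, for f_0 = z it is enough that z divides R at
    alpha_2 = 0: the only part of R not divisible by z carries the factor
    alpha_2.

    At beta_1 = 0 the normalization forces alpha_2 = 1/2.  There P is divisible
    by x (x - eta) and Q by y (y - 1) ([D4_P_factor], [D4_Q_factor]).  As
    x - eta and y - 1 differ from x and y by constants, they have the
    derivatives x' and y', which are multiples of P and Q.  So each of the four
    factors x, y, x - eta, y - 1 of f_1 divides its own derivative, and f_1 is
    an invariant divisor. *)

Section FractionDerivation.
Context {K : fieldType}.
Implicit Types u w : {fraction {poly K}}.

Lemma frac_quotient u : exists p q : {poly K}, q != 0 /\ u = p%:F / q%:F.
Proof.
exists \n_(repr u), \d_(repr u); split; last exact: frac_repr.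
by rewrite denom_ratioP.
Qed.

Lemma frac_derivC (c : K) : frac_deriv (c%:P)%:F = 0.
Proof.
rewrite -[X in frac_deriv X]divr1 -tofrac1 frac_deriv_div ?oner_neq0 //.
by rewrite !derivC mul0r mulr0 subrr tofrac0 mul0r.
Qed.

Lemma frac_derivB : {morph @frac_deriv K : u w / u - w}.
Proof.
move=> u w.
have [p [q [q0 ->]]] := frac_quotient u; have [r [s [s0 ->]]] := frac_quotient w.
have -> : p%:F / q%:F - r%:F / s%:F = (p * s - r * q)%:F / (q * s)%:F.
  by rewrite -mulNr addf_div ?tofrac_eq0 // mulNr -!tofracM -tofracB.
rewrite !frac_deriv_div ?mulf_neq0 // -[X in _ = _ + X]mulNr.
rewrite addf_div ?tofrac_eq0 ?expf_neq0 // mulNr -!tofracM -tofracB.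
by congr (_%:F / _%:F); rewrite ?derivB ?derivM; ring.
Qed.

Lemma frac_derivM u w :
  frac_deriv (u * w) = frac_deriv u * w + u * frac_deriv w.
Proof.
have [p [q [q0 ->]]] := frac_quotient u; have [r [s [s0 ->]]] := frac_quotient w.
rewrite mulf_div -!tofracM !frac_deriv_div ?mulf_neq0 //.
rewrite !mulf_div -!tofracM addf_div ?tofrac_eq0 ?mulf_neq0 ?expf_neq0 //.
rewrite -!tofracM -tofracD; apply/eqP.
rewrite eqr_div ?tofrac_eq0 ?mulf_neq0 ?expf_neq0 // -!tofracM.
by apply/eqP; congr (_%:F); rewrite !derivM; ring.
Qed.

HB.instance Definition _ := GRing.isZmodMorphism.Build
  {fraction {poly K}} {fraction {poly K}} (@frac_deriv K) frac_derivB.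

End FractionDerivation.

Section InvariantDivisorTheory.
Context {K : fieldType} {n : nat}.
Let A := {mpoly {fraction {poly K}}[n]}.
Variable v : 'I_n -> A.
Implicit Types f g : A.

(** Each of the two summands of [deriv_along] obeys the product rule: the one
    acting on coefficients because a coefficient of f g is a convolution of
    those of f and g, the other because partial derivatives are derivations. *)
Lemma deriv_alongM f g :
  deriv_along v (f * g) = deriv_along v f * g + f * deriv_along v g.
Proof.
have leibniz (B : comNzRingType) (p p' q q' w : B) :
    (p' * q + p * q') * w = p' * w * q + p * (q' * w) by ring.
have coefM : map_mpoly (@frac_deriv K) (f * g)
    = map_mpoly (@frac_deriv K) f * g + f * map_mpoly (@frac_deriv K) g.
  apply/mpolyP => m; rewrite mcoeffD mcoeff_map_mpoly !mcoeffM raddf_sum.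
  rewrite -big_split; apply: eq_bigr => k _ /=.
  by rewrite frac_derivM !mcoeff_map_mpoly.
have termM (i : 'I_n) : (f * g)^`M(i) * v i
    = f^`M(i) * v i * g + f * (g^`M(i) * v i) by rewrite mderivM leibniz.
rewrite /deriv_along coefM (eq_bigr _ (fun i _ => termM i)) big_split /=.
rewrite -mulr_suml.
rewrite -mulr_sumr.
(* With the sums and images abstracted, the ring identity is matched without
   unfolding polynomial arithmetic. *)
move: (\sum_(i < n) _) (\sum_(i < n) _) (map_mpoly _ f) (map_mpoly _ g).
by move=> p q r s; rewrite addrACA -mulrDl -mulrDr.
Qed.

Lemma deriv_alongBC f (c : K) :
  deriv_along v (f - ((c%:P)%:F)%:MP) = deriv_along v f.
Proof.
rewrite /deriv_along raddfB /= map_mpolyC /= frac_derivC.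
rewrite mpolyC0 subr0.
by congr (_ + _); apply: eq_bigr => i _; rewrite mderivB mderivC subr0.
Qed.

Lemma invariant_divisorM f g :
  invariant_divisor v f -> invariant_divisor v g ->
  invariant_divisor v (f * g).
Proof.
move=> [p fp] [q gq]; exists (p + q).
by rewrite deriv_alongM fp gq mulrDr mulrAC -!mulrA.
Qed.

End InvariantDivisorTheory.

Section Specializations.
Context {A : comNzRingType}.
Variables e x y z : A.

(** P is affine in alpha_2, so the two sides differ by a multiple of
    2 alpha_2 - 1, whose cofactor is half the alpha_2-coefficient of P. *)
Lemma D4_P_factor (a2 : A) : 2 * a2 = 1 ->
  D4_P e 0 0 a2 0 0 x y z =
    x * (x - e) *
    (x ^+ 2 + (2 - 4 * y - e) * x + 3 * y ^+ 2 + (2 * e - 3) * y + 1 - e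
     - 2 * (y - 1) * y * z * (2 * x - 2 * y + 1 - e)).
Proof.
move=> h; apply: subr0_eq.
transitivity ((2 * a2 - 1) *
  (- 4 * x ^+ 3 * y + 3 * x ^+ 2 * y ^+ 2 - (3 - 6 * e) * x ^+ 2 * y
   - 3 * e * x * y ^+ 2 + 2 * x ^+ 3 + (e ^+ 2 - 3 * e + 1) * x ^+ 2
   + (3 * e - 2 * e ^+ 2) * x * y + (e - 1) * e * x)).
  by rewrite /D4_P; ring.
by rewrite h subrr mul0r.
Qed.

(** As in [D4_P_factor], the cofactor of 2 alpha_2 - 1 is half the
    alpha_2-coefficient of Q. *)
Lemma D4_Q_factor (a2 : A) : 2 * a2 = 1 ->
  D4_Q e 0 0 a2 0 0 x y z =
    y * (y - 1) *
    (y ^+ 2 + (2 * e - 1 - 4 * x) * y + 3 * x ^+ 2 + (2 - 3 * e) * x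
     + e ^+ 2 - e + 2 * x * z * (x - e) * (2 * x - 2 * y + 1 - e)).
Proof.
move=> h; apply: subr0_eq.
transitivity ((2 * a2 - 1) *
  (- 4 * x * y ^+ 3 + 3 * x ^+ 2 * y ^+ 2 - 3 * x ^+ 2 * y
   + (6 - 3 * e) * x * y ^+ 2 + 2 * e * y ^+ 3 + (e ^+ 2 - 3 * e) * y ^+ 2
   + (3 * e - 2) * x * y - (e - 1) * e * y)).
  by rewrite /D4_Q; ring.
by rewrite h subrr mul0r.
Qed.

Lemma D4_R_factor (a0 a1 a3 a4 : A) :
  exists g, D4_R e a0 a1 0 a3 a4 x y z = z * g.
Proof.
have factor_z u w : u * z ^+ 2 + z * w = z * (u * z + w) by ring.
by eexists; rewrite /D4_R mul0r addr0 factor_z.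
Qed.

End Specializations.

Section InvariantDivisorsOfD4.
Context {K : fieldType}.
Variables (eta : K) (b : {fraction {poly K}}).

Lemma cst0 : cst (0 : K) = 0.
Proof. by rewrite /cst polyC0 tofrac0 mpolyC0. Qed.

Lemma cst1 : cst (1 : K) = 1.
Proof. by rewrite /cst polyC1 tofrac1 mpolyC1. Qed.

Lemma cstD (c d : K) : cst (c + d) = cst c + cst d.
Proof. by rewrite /cst polyCD tofracD mpolyCD. Qed.

Lemma D4_invariant_divisor_z (a0 a1 a3 a4 : K) :
  invariant_divisor (D4_system eta b a0 a1 0 a3 a4) varz.
Proof.
rewrite /invariant_divisor [deriv_along _ _]deriv_alongX /D4_system /= cst0.
have [g ->] := D4_R_factor (cst eta) varx vary varz
                 (cst a0) (cst a1) (cst a3) (cst a4).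
by rewrite scalerAr; eexists.
Qed.

(** The hypothesis is the normalization of the parameters once all of them but
    alpha_2 vanish. *)
Lemma D4_invariant_divisor_xy (a2 : K) : 2 * a2 = 1 ->
  invariant_divisor (D4_system eta b 0 0 a2 0 0)
    (varx * vary * (varx - cst eta) * (vary - 1)).
Proof.
move=> a2_half; set v := D4_system _ _ _ _ _ _ _.
have h2 : 2 * cst a2 = 1.
  by rewrite mulr_natl mulr2n -cstD -cst1 -a2_half mulr_natl mulr2n.
have dx : deriv_along v varx = v 0 by exact: deriv_alongX.
have dy : deriv_along v vary = v 1 by exact: deriv_alongX.
have [g vx] : exists g, v 0 = varx * (varx - cst eta) * g.
  rewrite /v /D4_system /= cst0 (D4_P_factor _ _ _ _ _ h2).
  by rewrite scalerAr; eexists.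
have [h vy] : exists h, v 1 = vary * (vary - 1) * h.
  rewrite /v /D4_system /= cst0 (D4_Q_factor _ _ _ _ _ h2).
  by rewrite -mulrN scalerAr; eexists.
do 3?[apply: invariant_divisorM].
- by exists ((varx - cst eta) * g); rewrite dx vx mulrA.
- by exists ((vary - 1) * h); rewrite dy vy mulrA.
- exists (varx * g); rewrite [deriv_along _ _]deriv_alongBC dx vx.
  by rewrite mulrA [varx * _]mulrC.
(* Writing 1 as [cst 1] makes the last factor a constant shift of y. *)
- exists (vary * h); rewrite -cst1 [deriv_along _ _]deriv_alongBC dy vy cst1.
  by rewrite mulrA [vary * _]mulrC.
Qed.

End InvariantDivisorsOfD4.

Theorem proposition7p2 (R : realType) (eta : R[i])
    (b : {fraction {poly R[i]}}) (a0 a1 a2 a3 a4 : R[i])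
    (heta : eta != 0) (hb : b != 0)
    (ha : a0 + a1 + 2 * a2 + a3 + a4 = 1)
    (h43 : a4 = a3) (h30 : a3 = a0) (h01 : a0 = a1) :
  let beta0 := a2 in
  let beta1 := a1 in
  let v := D4_system eta b a0 a1 a2 a3 a4 in
  [/\ beta0 + 2 * beta1 = 1 / 2,
      beta0 = 0 -> invariant_divisor v varz
    & beta1 = 0 ->
      invariant_divisor v (varx * vary * (varx - cst eta) * (vary - 1))].
Proof.
have {}ha : 2 * (a2 + 2 * a1) = 1.
  by rewrite -[RHS]ha h43 h30 h01; ring.
rewrite h43 h30 h01 => beta0 beta1 v; split.
- have two_neq0 : 2 != 0 :> R[i] by rewrite Num.Theory.pnatr_eq0.
  by apply: (mulfI two_neq0); rewrite ha mul1r divff.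
- by rewrite /v /beta0 => ->; apply: D4_invariant_divisor_z.
- move=> b1; rewrite /v; move: ha; rewrite -/beta1 b1 mulr0 addr0.
  exact: D4_invariant_divisor_xy.
Qed.
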